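(* Let $P_0=\mathcal N(0,1)$ and $P_1=\mathcal N(\theta,1)$ for some $\theta>0$, in the sparse support recovery problem described in the context. Let $\delta>0$ and let $m\ge2$ be an even integer. The Simple Sequential Thresholding procedure (described in the context) with inputs $\delta$ and $m$ satisfies $\mathbb{P}_e<\delta$ provided $$m>\frac{\log s+\log\log_2\left(\frac{2n}{\delta}\right)+\log\left(\frac1\delta\right)}{\theta^2/4}.$$
   Context: Setting: $\mathcal S\subset\{1,\dots,n\}$ is an unknown support set with $|\mathcal S|=s$. For each $i$, one can draw i.i.d. samples of $Y_i$, where $Y_i\sim P_0$ if $i\notin\mathcal S$ and $Y_i\sim P_1$ if $i\in\mathcal S$, all samples independent. Simple Sequential Thresholding with inputs $\delta>0$ and even integer $m\ge2$: set $\mathcal S_1=\{1,\dots,n\}$ and $K=\lceil\log_2(2n/\delta)\rceil$. For $k=1,\dots,K$: for each $i\in\mathcal S_k$, draw $m/2$ fresh samples of $Y_i$ and let $T_i$ be their sum; set $\mathcal S_{k+1}=\{i\in\mathcal S_k: T_i>0\}$. Output $\hat{\mathcal S}=\mathcal S_{K+1}$. $\mathbb{P}_e=\mathbb{P}(\hat{\mathcal S}\ne\mathcal S)$. *)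

(* Defs.v *)
From HB Require Import structures.
From mathcomp Require Import all_boot all_order all_algebra.
From mathcomp Require Import all_classical all_reals all_analysis.
From mathcomp Require Import normal_distribution.
Set Implicit Arguments. Unset Strict Implicit. Unset Printing Implicit Defensive.
Import Order.TTheory GRing.Theory Num.Theory.
Local Open Scope classical_set_scope.
Local Open Scope ring_scope.

Definition log2 {R : realType} (x : R) : R := ln x / ln 2.

Definition sst_rounds {R : realType} (n : nat) (delta : R) : nat :=
  `| Num.max 0%Z (Num.ceil (log2 (n%:R *+ 2 / delta))) |%N.

Definition mutually_independent {R : realType} {d} {Omega : measurableType d}
  (P : probability Omega R) (I : finType) (X : I -> {RV P >-> R}) : Prop :=
  forall (J : {set I}) (B : I -> set R), (forall i, measurable (B i)) ->
    P (\big[setI/setT]_(i in J) (X i @^-1` B i))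
    = (\prod_(i in J) P (X i @^-1` B i))%E.

(* Simple Sequential Thresholding.  T i k is the statistic of index i in
   round k (the sum of the m/2 fresh samples drawn in that round).
   sst_stage T k is the set S_{k+1} after k rounds: S_1 = {1..n},
   S_{k+1} = { i in S_k : T_i > 0 }. *)
Fixpoint sst_stage (n K : nat) {R : realType} (T : 'I_n -> 'I_K -> R) (k : nat) : {set 'I_n} :=
  match k with
  | 0 => [set i : 'I_n | true]
  | k'.+1 => [set i in sst_stage T k' |
               if insub k' is Some kk then 0 < T i kk else false]
  end.

Definition sst_output {R : realType} (n K h : nat)
  (Y : 'I_n -> 'I_K -> 'I_h -> R) : {set 'I_n} :=
  sst_stage (fun i k => \sum_(j < h) Y i k j) K.

(* Main.v *)
(** A null index survives the [K] rounds with probability [2^-K], and a signal index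
    is lost in a given round with probability at most [1/2 * exp (- m theta^2 /
    4)], because the round statistic is normal with mean [m theta / 2] and
    variance [m / 2]. A union bound gives [(n - s) 2^-K + s K / 2 * exp (- m
    theta^2 / 4)]. For [delta <= 1] put [L = log2 (2n/delta)], [K = ceil L] and [u
    = K - L]; the first term is at most [delta/2 * 2^-u] and the second is less
    than [delta/2 * (1 + u/L)]. For [n >= 2] we have [L >= 2], and convexity gives
    [2^-u <= 1 - u/2], so that what is lost by rounding up [L] in the second term
    is regained in the first; for [n = 1] only one of the two terms is present. *)
Require Import Defs.
From HB Require Import structures.
From mathcomp Require Import all_boot all_order all_algebra.
From mathcomp Require Import all_classical all_reals all_analysis.
From mathcomp Require Import normal_distribution.
From mathcomp Require Import measurable_realfun ring lra.
Set Implicit Arguments.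
Unset Strict Implicit.
Unset Printing Implicit Defensive.
Import Order.TTheory GRing.Theory Num.Theory.
Local Open Scope classical_set_scope.
Local Open Scope ring_scope.

(** * Normal laws: densities, sums of independent variables, half-line masses *)

Lemma integral_normal_prob (R : realType) (m s : R) (f : R -> \bar R) :
  measurable_fun setT f ->
  (\int[normal_prob m s]_x `|f x| < +oo)%E ->
  (\int[normal_prob m s]_x f x =
   \int[lebesgue_measure]_x (f x * (normal_pdf m s x)%:E))%E.
Proof.
move=> mf finf.
have dom := normal_prob_dominates m s.
rewrite -(Radon_Nikodym_change_of_variables dom)//=; last first.
  by apply/integrableP; split.
apply: ae_eq_integral => //.
- by apply: emeasurable_funM => //; exact: mf.
- apply: emeasurable_funM; first exact: mf.
  by apply/measurable_EFinP; exact: measurable_normal_pdf.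
- apply: ae_eqe_mul2l => /=.
  (* The Radon-Nikodym derivative is known only through its integrals over measurable sets; these
     agree with those of [normal_pdf], so the two are equal almost everywhere. *)
  rewrite Radon_NikodymE/=.
  case: cid => /= h [h1 h2 h3].
  apply: integral_ae_eq => //=.
  + by apply/measurable_EFinP; exact: measurable_normal_pdf.
  + by move=> E _ mE; rewrite -h3.
Qed.

(* Completing the square: the conditional law of the first summand given that
   the sum is [z] is again normal. *)
Lemma normal_pdf_convol (R : realType) (a b s t x z : R) : 0 < s -> 0 < t ->
  let u := Num.sqrt (s ^+ 2 + t ^+ 2) in
  normal_pdf a s x * normal_pdf b t (z - x) =
  normal_pdf (a + b) u z *
  normal_pdf ((t ^+ 2 * a + s ^+ 2 * (z - b)) / (s ^+ 2 + t ^+ 2)) (s * t / u) x.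
Proof.
move=> s0 t0 u.
have s20 : 0 < s ^+ 2 by rewrite exprn_gt0.
have t20 : 0 < t ^+ 2 by rewrite exprn_gt0.
have st0 : 0 < s ^+ 2 + t ^+ 2 by rewrite addr_gt0.
have u0 : 0 < u by rewrite sqrtr_gt0.
have u2 : u ^+ 2 = s ^+ 2 + t ^+ 2 by rewrite sqr_sqrtr// ltW.
have v0 : 0 < s * t / u by rewrite divr_gt0// mulr_gt0.
rewrite !normal_pdfE ?gt_eqF// /normal_fun.
rewrite mulrACA [in RHS]mulrACA -!expRD; congr (_ * expR _); last first.
  rewrite expr_div_n exprMn u2; field.
  by rewrite !gt_eqF// ?exprn_gt0.
have pi0 := @pi_gt0 R.
rewrite /normal_peak -!invfM; congr (_^-1).
rewrite -!sqrtrM; last 2 first.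
- by rewrite mulrn_wge0// mulr_ge0 ?sqr_ge0// ltW.
- by rewrite mulrn_wge0// mulr_ge0 ?sqr_ge0// ltW.
congr Num.sqrt; rewrite expr_div_n exprMn u2; field.
by rewrite gt_eqF.
Qed.

(** Both measures give a half-open interval its length, and this determines Lebesgue measure. *)
Lemma lebesgue_measure_translation (R : realType) (x : R) (A : set R) :
  measurable A ->
  pushforward lebesgue_measure
    (fun y => x + y : measurableTypeR R) A = lebesgue_measure A.
Proof.
move=> mA.
have mx : @measurable_fun _ _ (measurableTypeR R) (measurableTypeR R)
  setT (fun y => x + y) by exact: measurable_funD.
apply/esym/lebesgue_measure_unique => //= _ [[a b]] _ <-.
rewrite /pushforward/=.
have -> : (fun y => x + y) @^-1` `]a, b]%classic = `]a - x, b - x]%classic.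
  by apply/seteqP; split => y /=; rewrite !in_itv/= => /andP[? ?]; apply/andP; split; lra.
rewrite !lebesgue_measure_itv/= !lte_fin ltrD2r; case: ifP => // _.
by rewrite -!EFinB; congr EFin; ring.
Qed.

Lemma normal_prob_translation (R : realType) (m s x : R) (B : set R) :
  measurable B ->
  normal_prob m s [set y | B (x + y)] =
  (\int[lebesgue_measure]_(z in B) (normal_pdf m s (z - x))%:E)%E.
Proof.
move=> mB.
have mx : measurable_fun [set: R] (fun y => x + y) by exact: measurable_funD.
have mf : measurable_fun [set: R] (fun z => (normal_pdf m s (z - x))%:E).
  apply/measurable_EFinP; apply: measurableT_comp; first exact: measurable_normal_pdf.
  exact: measurable_funB.
transitivity (\int[pushforward lebesgue_measure
    (fun y => (x + y)%R : measurableTypeR R)]_(z in B) (normal_pdf m s (z - x))%:E)%E.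
  rewrite ge0_integral_pushforward//.
  - by apply: eq_integral => y _ /=; rewrite addrC addKr.
  - exact: measurable_funTS.
  - by move=> y _; rewrite lee_fin normal_pdf_ge0.
apply: eq_measure_integral => A mA _; exact: lebesgue_measure_translation.
Qed.

(** Each section of the event is an integral of a shifted density over [B]. After Tonelli,
    [normal_pdf_convol] pulls out the density of the sum at [z], and the remaining conditional
    density integrates to 1. *)
Lemma normal_prob_convol (R : realType) (a b s t : R) (B : set R) :
  0 < s -> 0 < t -> measurable B ->
  (normal_prob a s \x normal_prob b t)%E [set z | B (z.1 + z.2)] =
  normal_prob (a + b) (Num.sqrt (s ^+ 2 + t ^+ 2)) B.
Proof.
move=> s0 t0 mB; set u := Num.sqrt _.
pose f (p : R * R) := ((\1_B p.2)%:E * (normal_pdf b t (p.2 - p.1))%:E)%E.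
have f0 p : (0 <= f p)%E by rewrite mule_ge0// lee_fin// normal_pdf_ge0.
have mf : measurable_fun [set: R * R] f.
  apply: emeasurable_funM; apply/measurable_EFinP.
    by apply: measurableT_comp => //; exact: measurable_indic.
  apply: measurableT_comp; first exact: measurable_normal_pdf.
  exact: measurable_funB.
pose h (p : R * R) := (f p * (normal_pdf a s p.1)%:E)%E.
have h0 p : (0 <= h p)%E by rewrite mule_ge0// lee_fin// normal_pdf_ge0.
have mh : measurable_fun [set: R * R] h.
  apply: emeasurable_funM => //; apply/measurable_EFinP.
  by apply: measurableT_comp => //; exact: measurable_normal_pdf.
have mA : measurable [set z : R * R | B (z.1 + z.2)].
  rewrite -[X in measurable X]setTI.
  by apply: measurable_funD => //; exact: measurableT.
have sectionE x : normal_prob b t (xsection [set z : R * R | B (z.1 + z.2)] x) =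
    (\int[lebesgue_measure]_z f (x, z))%E.
  have -> : xsection [set z : R * R | B (z.1 + z.2)] x = [set y | B (x + y)].
    by apply/seteqP; split => y; rewrite /xsection/= inE.
  rewrite normal_prob_translation// integral_mkcond.
  apply: eq_integral => z _; rewrite /f /= patchE indicE.
  by case: ifP => _; rewrite ?mul1e ?mul0e.
have mF : measurable_fun [set: R] (fun x => \int[lebesgue_measure]_z f (x, z))%E.
  exact: (@measurable_fun_fubini_tonelli_F _ _ _ _ _ lebesgue_measure).
rewrite /product_measure1/=.
under eq_integral do rewrite sectionE.
rewrite integral_normal_prob//; last first.
  (* The inner integral is the probability of a section, hence at most 1; this gives the finiteness
     needed to pass to the density. *)
  apply: (@le_lt_trans _ _ (\int[normal_prob a s]_x (cst 1 x))%E).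
    apply: ge0_le_integral => //=.
      by apply: measurableT_comp => //; exact: mF.
    move=> x _; rewrite -sectionE gee0_abs//; apply: probability_le1.
    exact: measurable_xsection.
  by rewrite integral_cst//= probability_setT mul1e ltry.
transitivity (\int[lebesgue_measure]_x \int[lebesgue_measure]_z h (x, z))%E.
  apply: eq_integral => x _; rewrite -ge0_integralZr//.
  - by apply: (measurableT_comp mf); exact: pair1_measurable.
  - by rewrite lee_fin normal_pdf_ge0.
rewrite fubini_tonelli//.
rewrite /normal_prob [RHS]integral_mkcond; apply: eq_integral => z _.
rewrite patchE; case: ifPn => zB; last first.
  rewrite integral0_eq// => x _.
  by rewrite /h /f/= indicE (negbTE zB) !mul0e.
under eq_integral => x _.
  rewrite /h /f/= indicE zB mul1e -EFinM mulrC normal_pdf_convol// EFinM.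
  over.
rewrite ge0_integralZl//= ?integral_normal_pdf ?mule1//.
- by apply/measurable_EFinP; exact: measurable_normal_pdf.
- by move=> x _; rewrite lee_fin normal_pdf_ge0.
- by rewrite lee_fin normal_pdf_ge0.
Qed.

Lemma normal_prob0_ge0 (R : realType) (s : R) : s != 0 ->
  normal_prob 0 s `[0, +oo[ = (2^-1)%:E.
Proof.
move=> s0.
have even : normal_pdf (0 : R) s =1 normal_pdf 0 s \o -%R.
  by move=> x /=; rewrite !normal_pdfE// /normal_fun !subr0 sqrrN.
have := integral_normal_pdf 0 s.
rewrite (ge0_symfun_integralT _ _ even); last 2 first.
- by move=> x; exact: normal_pdf_ge0.
- exact: continuous_normal_pdf.
rewrite (_ : [set x | 0 <= x] = `[0, +oo[%classic); last first.
  by apply/seteqP; split => x /=; rewrite in_itv/= andbT.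
rewrite -/(normal_prob 0 s `[0, +oo[) => h.
have : normal_prob 0 s `[0, +oo[ \is a fin_num by exact: fin_num_measure.
move: h; case: (normal_prob 0 s `[0, +oo[) => // r [h] _.
by congr EFin; lra.
Qed.

Lemma normal_prob0_le0 (R : realType) (s : R) : s != 0 ->
  normal_prob 0 s `]-oo, 0] = (2^-1)%:E.
Proof.
move=> s0; rewrite -(normal_prob0_ge0 s0) /normal_prob.
rewrite ge0_integration_by_substitution0.
- by apply: eq_integral => x _; rewrite !normal_pdfE// /normal_fun !subr0 sqrrN.
- by apply/measurable_EFinP; exact: measurable_normal_pdf.
- by move=> x; rewrite lee_fin normal_pdf_ge0.
Qed.

(* For [m >= 0] and [x <= 0] the density ratio of N(m,s^2) to N(0,s^2) at [x]
   is at most [exp (- m^2 / (2 s^2))]; this keeps the factor 1/2. *)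
Lemma normal_prob_le0 (R : realType) (m s : R) : 0 <= m -> 0 < s ->
  (normal_prob m s `]-oo, 0%R] <= (2^-1 * expR (- (m ^+ 2 / (s ^+ 2 *+ 2))))%:E)%E.
Proof.
move=> m0 s0; have s0' : s != 0 by rewrite gt_eqF.
rewrite mulrC EFinM -(normal_prob0_le0 s0') /normal_prob.
rewrite -ge0_integralZl//; last 2 first.
- by apply: measurable_funTS; apply/measurable_EFinP; exact: measurable_normal_pdf.
- by move=> x _; rewrite lee_fin normal_pdf_ge0.
apply: ge0_le_integral => //=.
- by move=> x _; rewrite lee_fin normal_pdf_ge0.
- by apply: measurable_funTS; apply/measurable_EFinP; exact: measurable_normal_pdf.
- apply: measurable_funTS; apply/measurable_EFinP; apply: measurable_funM => //.
  exact: measurable_normal_pdf.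
move=> x; rewrite in_itv/= => x0; rewrite -EFinM lee_fin !normal_pdfE//.
rewrite mulrCA ler_pM2l ?normal_peak_gt0// /normal_fun subr0 -expRD ler_expR.
have s2 : 0 < s ^+ 2 *+ 2 by rewrite mulrn_wgt0// exprn_gt0.
rewrite -[X in _ <= X + _]mulNr -mulrDl ler_pM2r ?invr_gt0//.
(* Once the common factors are cancelled, the comparison of exponents is [m * x <= 0]. *)
by have := mulr_ge0_le0 m0 x0; lra.
Qed.

(** * Independence relative to an event, and laws of block sums *)

(** Rectangles form a generating pi-system, so agreement on them extends to every measurable set.
    Scaling the product measure by [P E], rather than dividing by it, also covers a null event
    [E]. *)
Lemma joint_law_given (d : measure_display) (Omega : measurableType d)
  (R : realType) (P : probability Omega R) (E : set Omega)
  (mu nu : probability (measurableTypeR R) R) (X Z : Omega -> R) :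
  measurable E -> measurable_fun setT X -> measurable_fun setT Z ->
  (forall A B, measurable A -> measurable B ->
     P (E `&` (X @^-1` A `&` Z @^-1` B)) = (P E * (mu A * nu B))%E) ->
  forall C, measurable C ->
    P (E `&` (fun w => (X w, Z w)) @^-1` C) = (P E * (mu \x nu) C)%E.
Proof.
move=> mE mX mZ XZ C mC.
have mXZ : @measurable_fun _ _ Omega (measurableTypeR R * measurableTypeR R)%type
    setT (fun w => (X w, Z w)) by exact: measurable_fun_pair.
have PE : P E \is a fin_num by exact: fin_num_measure.
have PE0 : 0 <= fine (P E) by rewrite fine_ge0.
pose c : {nonneg R} := NngNum PE0.
pose G : set (set (measurableTypeR R * measurableTypeR R)) :=
  [set C | exists A, measurable A /\ exists B, measurable B /\ C = A `*` B].
pose m1 : {measure set (measurableTypeR R * measurableTypeR R) -> \bar R} :=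
  mscale c (mu \x nu)%E.
have m1E D : m1 D = (P E * (mu \x nu) D)%E by rewrite -(fineK PE).
have m12 : m1 C =
  pushforward (mrestr P mE)
    (fun w => (X w, Z w) : measurableTypeR R * measurableTypeR R) C.
  apply: (@measure_unique _ _ _ G (fun=> setT)) => //.
  - rewrite measurable_prod_measurableType; congr (<<s _ >>).
    rewrite predeqE; split => [[A mA [B mB <-]]|[A [mA [B [mB ->]]]]].
      by exists A; split => //; exists B.
    by exists A => //; exists B.
  - move=> _ _ [A1 [mA1 [B1 [mB1 ->]]]] [A2 [mA2 [B2 [mB2 ->]]]].
    rewrite -setXI; exists (A1 `&` A2); split; first exact: measurableI.
    by exists (B1 `&` B2); split => //; exact: measurableI.
  - by move=> _; exists setT; split => //; exists setT; split; rewrite ?setXTT.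
  - by apply/seteqP; split => // x _; exists 0%N.
  - move=> _ [A [mA [B [mB ->]]]].
    rewrite m1E product_measure1E// -XZ//.
    by rewrite /pushforward /mrestr setIC.
  - move=> _; rewrite m1E -setXTT product_measure1E//.
    have : (P E * (mu setT * nu setT) < +oo)%E.
      by rewrite !probability_setT !mule1 -ge0_fin_numE.
    exact.
transitivity (m1 C); last exact: m1E.
by rewrite m12 setIC.
Qed.

Section product_rule.
Context (d : measure_display) (Omega : measurableType d) (R : realType)
  (P : probability Omega R) (I : eqType) (X : I -> {RV P >-> R}).

(* The event [E] is carried along so that one block of samples can be summed while
   the samples of the other blocks are conditioned on. *)
Definition product_rule (g : I -> set R -> \bar R) (r : seq I) (E : set Omega) :=
  forall B : I -> set R, (forall i, measurable (B i)) ->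
  P (E `&` \big[setI/setT]_(i <- r) (X i @^-1` B i)) =
  (P E * \prod_(i <- r) g i (B i))%E.

Lemma measurable_rect (B : I -> set R) (r : seq I) :
  (forall i, measurable (B i)) ->
  measurable (\big[setI/setT]_(i <- r) (X i @^-1` B i)).
Proof.
move=> mB; elim/big_ind : _ => // [A C|i _]; first exact: measurableI.
by rewrite -[X in measurable X]setTI; exact: measurable_funP.
Qed.

Lemma product_rule_perm g r1 r2 E :
  perm_eq r1 r2 -> product_rule g r1 E -> product_rule g r2 E.
Proof.
move=> r12 rule B mB.
by rewrite -!(perm_big _ r12)/= rule.
Qed.

(** Constraints on [r1] can be absorbed into the given event without disturbing the rule on [r2]. *)
Lemma product_rule_split g r1 r2 E (B : I -> set R) :
  (forall i, g i setT = 1%E) -> uniq (r1 ++ r2) -> product_rule g (r1 ++ r2) E ->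
  (forall i, measurable (B i)) ->
  P (E `&` \big[setI/setT]_(i <- r1) (X i @^-1` B i)) =
    (P E * \prod_(i <- r1) g i (B i))%E /\
  product_rule g r2 (E `&` \big[setI/setT]_(i <- r1) (X i @^-1` B i)).
Proof.
move=> g1 ur rule mB.
have r12 i : i \in r2 -> i \in r1 = false.
  move: ur; rewrite cat_uniq => /and3P[_ /hasPn r12 _] /r12.
  exact: negbTE.
have glue B' : (forall i, measurable (B' i)) ->
  P (E `&` (\big[setI/setT]_(i <- r1) (X i @^-1` B i) `&`
            \big[setI/setT]_(i <- r2) (X i @^-1` B' i))) =
  (P E * (\prod_(i <- r1) g i (B i) * \prod_(i <- r2) g i (B' i)))%E.
  move=> mB'.
  (* The two lists are disjoint by uniqueness, so the two families merge into one. *)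
  pose D i := if i \in r1 then B i else B' i.
  have mD i : measurable (D i) by rewrite /D; case: ifP.
  have := rule D mD; rewrite !big_cat/=.
  have -> : \big[setI/setT]_(i <- r1) (X i @^-1` D i) =
            \big[setI/setT]_(i <- r1) (X i @^-1` B i).
    by apply: eq_big_seq => i; rewrite /D => ->.
  have -> : \big[setI/setT]_(i <- r2) (X i @^-1` D i) =
            \big[setI/setT]_(i <- r2) (X i @^-1` B' i).
    by apply: eq_big_seq => i /r12; rewrite /D => ->.
  have -> : (\prod_(i <- r1) g i (D i) = \prod_(i <- r1) g i (B i))%E.
    by apply: eq_big_seq => i; rewrite /D => ->.
  have -> // : (\prod_(i <- r2) g i (D i) = \prod_(i <- r2) g i (B' i))%E.
  by apply: eq_big_seq => i /r12; rewrite /D => ->.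
have PE1 : P (E `&` \big[setI/setT]_(i <- r1) (X i @^-1` B i)) =
    (P E * \prod_(i <- r1) g i (B i))%E.
  have := glue (fun=> setT) (fun=> measurableT).
  have -> : \big[setI/setT]_(i <- r2) (X i @^-1` [set: R]) = setT.
    by rewrite big1.
  have -> : (\prod_(i <- r2) g i [set: R] = 1)%E by rewrite big1.
  by rewrite setIT mule1.
split=> // B' mB'.
by rewrite -setIA glue// PE1 muleA.
Qed.

(** Induction on [r]: applied to [E] cut down by a constraint on the head, the induction hypothesis
    gives the joint law of tail sum and head; convolution then adds them. The induction starts at
    singletons, since an empty sum is constant. *)
Lemma normal_sum_given (mu : I -> R) r E :
  r != [::] -> uniq r -> measurable E ->
  product_rule (fun i => normal_prob (mu i) 1) r E ->
  forall B, measurable B ->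
  P (E `&` (fun w => \sum_(i <- r) X i w) @^-1` B) =
  (P E * normal_prob (\sum_(i <- r) mu i) (Num.sqrt (size r)%:R) B)%E.
Proof.
elim: r E => // i [|j r] IH E _ ur mE rule B mB.
  have := rule (fun=> B) (fun=> mB).
  rewrite !big_seq1 sqrtr1 => <-.
  by under eq_fun do rewrite big_seq1.
have g1 k : normal_prob (mu k) 1 setT = 1%E by exact: probability_setT.
move: ur IH; rewrite -cat1s; set r' := j :: r => ur IH.
have r'0 : (0 < size r')%N by [].
pose mu' := \sum_(k <- r') mu k.
pose s' := Num.sqrt (size r')%:R : R.
have msum : measurable_fun setT (fun w => \sum_(k <- r') X k w).
  by apply: measurable_sum => k; exact: measurable_funP.
have joint A C : measurable A -> measurable C ->
    P (E `&` ((fun w => \sum_(k <- r') X k w) @^-1` A `&` X i @^-1` C)) =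
    (P E * (normal_prob mu' s' A * normal_prob (mu i) 1 C))%E.
  move=> mA mC.
  have [] := product_rule_split (B := fun=> C) g1 ur rule (fun=> mC).
  rewrite !big_seq1 => PEC ruleC.
  rewrite [X in E `&` X]setIC setIA IH//.
  - by rewrite PEC -muleA [X in (_ * X)%E]muleC.
  - by move: ur; rewrite cat_uniq => /and3P[].
  - apply: measurableI => //; rewrite -[X in measurable X]setTI.
    exact: measurable_funP.
have mXi : measurable_fun setT (X i) by exact: measurable_funP.
have mA : measurable [set z : R * R | B (z.1 + z.2)].
  rewrite -[X in measurable X]setTI.
  by apply: measurable_funD => //; exact: measurableT.
have s'0 : 0 < s' by rewrite sqrtr_gt0 ltr0n.
transitivity (P (E `&` (fun w => (\sum_(k <- r') X k w, X i w)) @^-1`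
    [set z | B (z.1 + z.2)])).
  congr (P (_ `&` _)); apply/seteqP.
  by split => w /=; rewrite big_cons addrC.
rewrite (joint_law_given mE msum mXi joint mA); congr (_ * _)%E.
apply: etrans (normal_prob_convol mu' (mu i) s'0 ltr01 mB) _.
have -> : \sum_(k <- [:: i] ++ r') mu k = mu' + mu i by rewrite big_cons addrC.
suff -> : Num.sqrt (size ([:: i] ++ r'))%:R = Num.sqrt (s' ^+ 2 + 1 ^+ 2) by [].
by rewrite expr1n sqr_sqrtr ?ler0n// natr1.
Qed.

(** Induction on the blocks, absorbing the event on the first block sum into [E]. *)
Lemma normal_block_sums_given (K : eqType) (f : K -> seq I) (ks : seq K)
    (mu : I -> R) E :
  (forall k, f k != [::]) -> uniq (flatten [seq f k | k <- ks]) ->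
  measurable E ->
  product_rule (fun i => normal_prob (mu i) 1) (flatten [seq f k | k <- ks]) E ->
  forall C : K -> set R, (forall k, measurable (C k)) ->
  P (E `&` \big[setI/setT]_(k <- ks) ((fun w => \sum_(i <- f k) X i w) @^-1` C k)) =
  (P E * \prod_(k <- ks)
     normal_prob (\sum_(i <- f k) mu i) (Num.sqrt (size (f k))%:R) (C k))%E.
Proof.
move=> f0 + + + C mC.
have g1 i : normal_prob (mu i) 1 setT = 1%E by exact: probability_setT.
elim: ks E => [|k ks IH] E /=; first by rewrite !big_nil setIT mule1.
set rest := flatten _ => ur mE rule.
have urC : uniq (rest ++ f k) by rewrite uniq_catC.
have ruleC : product_rule (fun i => normal_prob (mu i) 1) (rest ++ f k) E.
  by apply: product_rule_perm rule; rewrite perm_catC.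
have ufk : uniq (f k) by move: ur; rewrite cat_uniq => /and3P[].
have urest : uniq rest by move: urC; rewrite cat_uniq => /and3P[].
have [_ rulek] := product_rule_split g1 urC ruleC (fun=> measurableT).
rewrite big1 ?setIT in rulek; last by move=> i _; exact: preimage_setT.
set T := fun w => \sum_(i <- f k) X i w.
have mT : measurable (T @^-1` C k).
  rewrite -[X in measurable X]setTI.
  have : measurable_fun setT T.
    by apply: measurable_sum => i; exact: measurable_funP.
  exact.
have PET := normal_sum_given (f0 k) ufk mE rulek (mC k).
rewrite !big_cons setIA IH//.
- by rewrite PET muleA.
- exact: measurableI.
(* The rule must still hold on [rest] given the event on the block sum. For this the roles are
   exchanged: the rectangle on [rest] joins [E], and the sum over [f k] is evaluated given both. *)
move=> B mB.
have [PErest rule_rest] := product_rule_split g1 urC ruleC mB.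
have mErest : measurable (E `&` \big[setI/setT]_(i <- rest) (X i @^-1` B i)).
  by apply: measurableI => //; exact: measurable_rect.
have := normal_sum_given (f0 k) ufk mErest rule_rest (mC k).
by rewrite -setIA [X in E `&` X]setIC setIA => ->; rewrite PErest PET muleAC.
Qed.
End product_rule.

(** * Numerical estimates on the number of rounds *)

(** By convexity [expR] lies below its chord between [- ln 2] and [0]. *)
Lemma expR_Nln2_le (R : realType) (u : R) : 0 <= u -> u <= 1 ->
  expR (- (u * ln 2)) <= 1 - u / 2.
Proof.
move=> u0 u1.
have := convex_expR (Itv01 u0 u1) (- ln 2) 0.
rewrite !convRE/= mulr0 addr0 mulrN expR0 mulr1 expRN lnK ?posrE//.
rewrite /unstable.onem; lra.
Qed.

Lemma sst_rounds_bounds (R : realType) (n : nat) (delta : R) :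
  let L := log2 (n%:R *+ 2 / delta) in
  0 <= L -> L <= (sst_rounds n delta)%:R < L + 1.
Proof.
move=> L L0.
have -> : (sst_rounds n delta)%:R = (Num.ceil L)%:~R :> R.
  rewrite /sst_rounds -/L max_r; last by rewrite ceil_ge0; lra.
  by rewrite natr_absz ger0_norm// ceil_ge0; lra.
have := ceil_itv L.
by move=> /andP[h1 h2]; rewrite h2/=; move: h1; rewrite intrD; lra.
Qed.

Lemma log2_ge1 (R : realType) (n : nat) (delta : R) :
  0 < delta -> delta <= 1 -> (0 < n)%N -> 1 <= log2 (n%:R *+ 2 / delta).
Proof.
move=> d0 d1 n0; have n1 : 1 <= n%:R :> R by rewrite ler1n.
have ln20 : 0 < ln (2 : R) by rewrite ln_gt0// ltr1n.
have q2 : 2 <= n%:R *+ 2 / delta by rewrite ler_pdivlMr//; nra.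
rewrite /log2 ler_pdivlMr// mul1r ler_ln ?posrE//.
exact: lt_le_trans q2.
Qed.

(** Here [x] stands for [exp (- m theta^2 / 4)], and its upper bound is the sample-size condition in
    exponential form. That bound is asked only for [0 < s], because the quotient is 0 by convention
    at [s = 0]. *)
Lemma sst_union_bound (R : realType) (n s : nat) (delta x : R) :
  0 < delta -> delta <= 1 -> (0 < n)%N -> (s <= n)%N -> 0 <= x ->
  let L := log2 (n%:R *+ 2 / delta) in
  ((0 < s)%N -> x < delta / (s%:R * L)) ->
  (n - s)%:R * 2^-1 ^+ sst_rounds n delta +
    (s * sst_rounds n delta)%:R * (2^-1 * x) < delta.
Proof.
move=> d0 d1 n0 sn x0 L xlt.
have n1 : 1 <= n%:R :> R by rewrite ler1n.
have ln20 : 0 < ln (2 : R) by rewrite ln_gt0// ltr1n.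
pose q := n%:R *+ 2 / delta.
have q2 : 2 * n%:R <= q by rewrite /q ler_pdivlMr//; nra.
have q0 : 0 < q by lra.
have nq : n%:R * q^-1 = delta / 2.
  by rewrite /q; field; rewrite !gt_eqF//; lra.
have Lln : L * ln 2 = ln q by rewrite /L /log2 divfK// gt_eqF.
have L1 : 1 <= L by exact: log2_ge1.
have /andP[KL KL1] : L <= (sst_rounds n delta)%:R < L + 1.
  by apply: sst_rounds_bounds; apply: le_trans L1.
move: (sst_rounds n delta) KL KL1 => K KL KL1; clearbody L q.
have L2 : (1 < n)%N -> 2 <= L.
  move=> n2; have n2' : 2 <= n%:R :> R by rewrite ler_nat.
  rewrite -(ler_pM2r ln20) Lln mulr_natl -lnXn// ler_ln ?posrE ?exprn_gt0//.
  by rewrite expr2; lra.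
pose u := K%:R - L.
have u0 : 0 <= u by rewrite /u; lra.
have u1 : u <= 1 by rewrite /u; lra.
(* [2^-K] is [q^-1 * 2^-u], and [n / q = delta / 2]. *)
have pow_le : n%:R * 2^-1 ^+ K <= delta / 2 * (1 - u / 2).
  have -> : 2^-1 ^+ K = q^-1 * expR (- (u * ln 2)) :> R.
    rewrite -{1}(lnK (x := 2)) ?posrE// -expRN -expRM_natr.
    rewrite -[in RHS](lnK (x := q)) ?posrE// -expRN -expRD; congr expR.
    by rewrite -Lln /u; ring.
  rewrite mulrA nq.
  by rewrite ler_pM2l ?expR_Nln2_le//; lra.
have [->|s0] := posnP s.
  rewrite subn0 mul0n mul0r addr0; nra.
have {xlt} := xlt s0.
have s1 : 1 <= s%:R :> R by rewrite ler1n.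
rewrite ltr_pdivlMr; last by nra.
move=> xlt.
have half : (s * K)%:R * (2^-1 * x) < delta / 2 * (1 + u / L).
  have -> : delta / 2 * (1 + u / L) = K%:R / (2 * L) * delta.
    by rewrite /u; field; rewrite gt_eqF//; lra.
  have -> : (s * K)%:R * (2^-1 * x) = K%:R / (2 * L) * (x * (s%:R * L)).
    by rewrite natrM; field; rewrite gt_eqF//; lra.
  rewrite ltr_pM2l// divr_gt0//; nra.
(* For [n = 1] and [0 < s] there is no null index, and [u / L <= 1] is enough. Otherwise [L >= 2],
   so the excess [u / L] is at most the gain [u / 2] from [pow_le]. *)
have [n1'|n2] := leqP n 1.
  have -> : (n - s)%N = 0%N by apply/eqP; rewrite subn_eq0 (leq_trans n1').
  rewrite mul0r add0r (lt_le_trans half)//.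
  have : u / L <= 1 by rewrite ler_pdivrMr; lra.
  nra.
have uL : u / L <= u / 2.
  by rewrite ler_wpM2l// lef_pV2 ?posrE ?L2//; lra.
have : (n - s)%:R * 2^-1 ^+ K <= n%:R * 2^-1 ^+ K :> R.
  by rewrite ler_wpM2r ?exprn_ge0 ?invr_ge0// ler_nat leq_subr.
nra.
Qed.

(** * The error event of the procedure and its probability *)

Lemma normal_prob0_gt0 (R : realType) (s : R) : s != 0 ->
  normal_prob 0 s `]0, +oo[ = (2^-1)%:E.
Proof.
move=> s0; rewrite -setCitvl.
have mN : measurable (`]-oo, 0] : set R) by exact: measurable_itv.
apply: (etrans (probability_setC (normal_prob 0 s) mN)).
apply: (etrans (congr1 (fun x => 1 - x)%E (normal_prob0_le0 s0))).
by rewrite -EFinB; congr EFin; lra.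
Qed.

(** Unrolls the recursion; for [k <= K] the default [false] of [insub] is never reached. *)
Lemma mem_sst_stage (R : realType) (n K : nat) (T : 'I_n -> 'I_K -> R)
    (k : nat) (i : 'I_n) : (k <= K)%N ->
  (i \in sst_stage T k) = [forall r : 'I_K, (r < k)%N ==> (0 < T i r)].
Proof.
elim: k => [_|k IH kK] /=; first by rewrite inE; apply/esym/forallP.
rewrite inE IH; last exact: ltnW.
rewrite insubT; apply/andP/forallP => [[/forallP lt_k Tk] r|h].
  apply/implyP; rewrite ltnS leq_eqVlt => /predU1P[rk|]; last exact/implyP.
  by rewrite (_ : r = Sub k kK)//; exact: val_inj.
split; last by have /implyP := h (Sub k kK); apply => /=.
by apply/forallP => r; apply/implyP => rk; apply: (implyP (h r)); exact: ltnW.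
Qed.

(** Measurability is carried through the induction because subadditivity asks for it at each
    step. *)
Lemma measure_bigU_le (d : measure_display) (Omega : measurableType d)
  (R : realType) (P : {measure set Omega -> \bar R}) (I : finType)
  (D : pred I) (F : I -> set Omega) (b : I -> \bar R) :
  (forall i, D i -> measurable (F i)) ->
  (forall i, D i -> (P (F i) <= b i)%E) ->
  measurable (\big[setU/set0]_(i | D i) F i) /\
  (P (\big[setU/set0]_(i | D i) F i) <= \sum_(i | D i) b i)%E.
Proof.
move=> mF Fb; pose Q A (x : \bar R) := measurable A /\ (P A <= x)%E.
rewrite -/(Q _ _); apply: big_rec2; first by split; rewrite ?measure0.
move=> i A x Di [mA PA]; split; first by apply: measurableU => //; exact: mF.
by apply: (le_trans (measureU2 P (mF i Di) mA)); exact: leeD (Fb i Di) PA.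
Qed.

Lemma sst_error_le (R : realType) (d : measure_display) (Omega : measurableType d)
  (P : probability Omega R) (n K h : nat) (S : {set 'I_n}) (theta : R)
  (Y : 'I_n * 'I_K * 'I_h -> {RV P >-> R}) :
  0 < theta -> (0 < h)%N ->
  (forall i k j B, measurable B ->
     P (Y (i, k, j) @^-1` B) = normal_prob (if i \in S then theta else 0) 1 B) ->
  mutually_independent Y ->
  (P [set w | sst_output (fun i k j => Y (i, k, j) w) != S] <=
   ((n - #|S|)%:R * 2^-1 ^+ K +
    (#|S| * K)%:R * (2^-1 * expR (- (h%:R * theta ^+ 2 / 2))))%:E)%E /\
  measurable [set w | sst_output (fun i k j => Y (i, k, j) w) != S].
Proof.
move=> theta0 h0 lawY indepY.
pose mu (x : 'I_n * 'I_K * 'I_h) : R := if x.1.1 \in S then theta else 0.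
pose block (i : 'I_n) (k : 'I_K) := [seq (i, k, j) | j <- enum 'I_h].
(* A duplicate-free list is read as the finite set that [mutually_independent] expects. *)
have rule r : uniq r -> product_rule Y (fun x => normal_prob (mu x) 1) r setT.
  move=> ur B mB; rewrite setTI probability_setT mul1e.
  rewrite !(big_uniq _ ur)/=.
  rewrite -(eq_bigl _ _ (finset.in_set (mem r))) indepY//.
  rewrite -[RHS](eq_bigl _ _ (finset.in_set (mem r))).
  by apply: eq_bigr => -[[i k] j] _; exact: lawY.
have size_block i k : size (block i k) = h by rewrite size_map size_enum_ord.
have block0 i k : block i k != [::] by rewrite -size_eq0 size_block -lt0n.
have ublock i k : uniq (block i k).
  by rewrite map_inj_uniq ?enum_uniq// => j j' [].
pose T i k w := \sum_(x <- block i k) Y x w.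
have TE i k w : T i k w = \sum_(j < h) Y (i, k, j) w.
  by rewrite /T big_map big_enum.
have mT i k : measurable_fun setT (T i k).
  by apply: measurable_sum => x; exact: measurable_funP.
have mTB i k B : measurable B -> measurable (T i k @^-1` B).
  by move=> mB; rewrite -[X in measurable X]setTI; exact: mT.
have mu_block i k : \sum_(x <- block i k) mu x = if i \in S then theta *+ h else 0.
  rewrite big_map big_enum /mu/=; case: ifP => _; last by rewrite big1.
  by rewrite sumr_const card_ord.
pose sd : R := Num.sqrt h%:R.
have sd0 : 0 < sd by rewrite sqrtr_gt0 ltr0n.
pose survive i := \big[setI/setT]_(k <- enum 'I_K) (T i k @^-1` `]0, +oo[).
pose lost (x : 'I_n * 'I_K) := T x.1 x.2 @^-1` `]-oo, 0].
have msurvive i : measurable (survive i).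
  rewrite /survive; elim/big_ind : _ => // [A C|k _]; first exact: measurableI.
  exact: mTB.
have mlost x : measurable (lost x) by exact: mTB.
(* The [K] block sums of a null index are independent centred normals, each positive with
   probability 1/2. *)
have Psurvive i : i \in ~: S -> (P (survive i) <= (2^-1 ^+ K)%:E)%E.
  rewrite inE => iS.
  have uflat : uniq (flatten [seq block i k | k <- enum 'I_K]).
    by apply: allpairs_uniq; rewrite ?enum_uniq// => -[k j] [k' j'] _ _ [-> ->].
  have := normal_block_sums_given (block0 i) uflat measurableT (rule _ uflat)
    (C := fun=> `]0, +oo[%classic) (fun=> measurable_itv _).
  rewrite setTI probability_setT mul1e -/(survive i) => ->.
  rewrite big_enum/= (eq_bigr (fun=> (2^-1)%:E)).
    by rewrite prodEFin prodr_const card_ord.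
  move=> k _; rewrite mu_block (negbTE iS) size_block -/sd.
  by rewrite normal_prob0_gt0 ?gt_eqF.
have Plost x : x.1 \in S ->
    (P (lost x) <= (2^-1 * expR (- (h%:R * theta ^+ 2 / 2)))%:E)%E.
  case: x => i k /= iS.
  have := normal_sum_given (block0 i k) (ublock i k) measurableT (rule _ (ublock i k))
    (measurable_itv `]-oo, 0]).
  rewrite setTI probability_setT mul1e /lost/= => ->.
  rewrite mu_block iS size_block -/sd.
  apply: (le_trans (normal_prob_le0 (mulrn_wge0 _ (ltW theta0)) sd0)).
  (* Mean [h * theta] and variance [h] give the exponent [(h theta)^2 / (2 h)]. *)
  rewrite lee_fin le_eqVlt; apply/orP; left; apply/eqP; congr (_ * expR (- _)).
  rewrite /sd sqr_sqrtr ?ler0n// -[theta *+ h]mulr_natr; field.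
  by rewrite pnatr_eq0 -lt0n.
(* Statistics exist in every round, even after an index has been dropped. So a signal index is
   missing from the output exactly when some [lost (i, k)] occurs, whatever the earlier rounds
   did. *)
have errE : [set w | sst_output (fun i k j => Y (i, k, j) w) != S] =
    \big[setU/set0]_(i in ~: S) survive i `|`
    \big[setU/set0]_(x : 'I_n * 'I_K | x.1 \in S) lost x.
  rewrite -(bigcup_pred (mem (~: S))).
  rewrite -(bigcup_pred [pred x : 'I_n * 'I_K | x.1 \in S]).
  have survivedP i w : reflect (survive i w)
      (i \in sst_output (fun i k j => Y (i, k, j) w)).
    rewrite /sst_output mem_sst_stage//; apply: (iffP forallP) => [h' | h' k].
      rewrite /survive -bigcap_seq => k _ /=; rewrite in_itv/= andbT TE.
      exact: (implyP (h' k)).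
    apply/implyP => _; move: h'; rewrite /survive -bigcap_seq => /(_ k).
    by rewrite /= mem_enum in_itv/= andbT TE; apply.
  apply/seteqP; split=> w /=.
    move=> ne; have /existsP[i] :
        [exists i, (i \in sst_output (fun i k j => Y (i, k, j) w)) != (i \in S)].
      apply: contraNT ne; rewrite negb_exists => /forallP eqS.
      by apply/eqP/setP => i; apply/eqP; have := eqS i; rewrite negbK.
    have [iS|iS] := boolP (i \in S); last first.
      rewrite eqbF_neg negbK => /survivedP iw; left.
      by exists i => //=; rewrite inE.
    rewrite eqb_id /sst_output mem_sst_stage// negb_forall => /existsP[k].
    rewrite negb_imply ltn_ord/= -leNgt => Tk; right.
    by exists (i, k) => //=; rewrite /lost/= in_itv/= TE.
  move=> [[i /= iS iw]|[[i k] /= iS]].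
    apply: contraTneq iS => <-; rewrite inE negbK; exact/survivedP.
  move=> Tk; have {Tk} : T i k w \in `]-oo, 0] := Tk; rewrite in_itv/= => Tk.
  apply: contraTneq iS => <-; apply/negP => /survivedP.
  rewrite /survive -bigcap_seq => /(_ k)/=.
  by rewrite mem_enum in_itv/= andbT => /(_ isT); rewrite ltNge Tk.
have [mU1 U1] := measure_bigU_le (fun i _ => msurvive i) Psurvive.
have [mU2 U2] := measure_bigU_le (fun x _ => mlost x) Plost.
rewrite errE; split; last exact: measurableU.
apply: (le_trans (measureU2 P mU1 mU2)).
apply: (le_trans (leeD U1 U2)).
rewrite !sumEFin !sumr_const -EFinD lee_fin.
have -> : #|~: S| = (n - #|S|)%N by rewrite cardsCs finset.setCK card_ord.
have -> : #|(fun x : 'I_n * 'I_K => x.1 \in S)| = (#|S| * K)%N.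
  rewrite -[K in RHS]card_ord -cardsT -cardsX; apply: eq_card => x.
  by rewrite !inE andbT.
by rewrite !mulr_natl.
Qed.

Theorem theorem4 (R : realType) (d : measure_display) (Omega : measurableType d)
  (P : probability Omega R) (n : nat) (S : {set 'I_n})
  (theta delta : R) (m : nat)
  (Y : 'I_n * 'I_(sst_rounds n delta) * 'I_(m./2) -> {RV P >-> R}) :
  0 < theta -> 0 < delta -> (2 <= m)%N -> ~~ odd m ->
  (* Y (i, k, j) is the j-th sample of Y_i drawn in round k:
     Y_i ~ N(0,1) if i \notin S and Y_i ~ N(theta,1) if i \in S *)
  (forall i k j B, measurable B ->
     P (Y (i, k, j) @^-1` B) = normal_prob (if i \in S then theta else 0) 1 B) ->
  (* all samples independent *)
  mutually_independent Y ->
  m%:R > (ln (#|S|%:R) + ln (log2 (n%:R *+ 2 / delta)) + ln (1 / delta))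
         / (theta ^+ 2 / 4) ->
  (P [set w | sst_output (fun i k j => Y (i, k, j) w) != S] < delta%:E)%E.
Proof.
move=> theta0 delta0 m2 m_even lawY indepY m_large.
have h0 : (0 < m./2)%N by rewrite half_gt0.
have [Perr merr] := sst_error_le theta0 h0 lawY indepY.
(* For [delta > 1] the claim is trivial; the estimates on [L] assume [delta <= 1]. *)
have [delta1|delta1] := ltP 1 delta.
  by apply: (@le_lt_trans _ _ 1%E); [exact: probability_le1|rewrite lte_fin].
apply: (le_lt_trans Perr); rewrite lte_fin.
have Sn : (#|S| <= n)%N by rewrite -[n in leqRHS]card_ord max_card.
have [n0|n0] := posnP n.
  have -> : #|S| = 0%N by apply/eqP; rewrite -leqn0 -n0.
  by rewrite subn0 {1}n0 !mul0r addr0.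
apply: sst_union_bound => //.
move=> s0; have L1 := log2_ge1 delta0 delta1 n0.
have L0 : 0 < log2 (n%:R *+ 2 / delta) by apply: lt_le_trans L1.
have s0' : 0 < #|S|%:R :> R by rewrite ltr0n.
have q0 : 0 < delta / (#|S|%:R * log2 (n%:R *+ 2 / delta)).
  by apply: divr_gt0 => //; exact: mulr_gt0.
(* In logarithms the required bound is the sample-size condition; [s] and [L] are positive here, so
   the logarithm of the quotient splits. *)
rewrite -[X in _ < X]lnK ?posrE// ltr_expR.
rewrite ln_div ?posrE//; last exact: mulr_gt0.
rewrite lnM ?posrE//.
move: m_large; rewrite ltr_pdivrMr ?divr_gt0 ?exprn_gt0// div1r lnV ?posrE//.
(* Evenness of [m] turns [h theta^2 / 2] into [m theta^2 / 4]. *)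
have -> : (m%:R : R) = 2 * (m./2)%:R.
  by rewrite -[in LHS](even_halfK m_even) -mul2n natrM.
lra.
Qed.
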